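(* Let $b$ be a positive integer. A $b$-colored partition of $n$ is a finite multiset of colored parts $r_c$, with $r\ge1$ and $c\in\{1,\dots,b\}$, whose sizes $r$ (counted with multiplicity) sum to $n$. Fix a positive integer $k$. Let $F_k(n)$ be the total number of parts of size $k$ (of any color, counted with multiplicity) in all $b$-colored partitions of $n$. For a $b$-colored partition $\pi$, let $H_k(\pi)=\sum r$, the sum over the distinct colored parts $r_c$ occurring in $\pi$ with $k\mid r$ (each distinct colored part $r_c$ counted once regardless of its multiplicity, contributing its size $r$), and let $H_k(n)=\sum_\pi H_k(\pi)$ over all $b$-colored partitions $\pi$ of $n$, with $H_k(m)=0$ for $m<0$. Then for all positive integers $n$, $$kF_k(n)=H_k(n)-H_k(n-k).$$
   Context: For example, with $b=2$, the partition $3_1+3_2+6_1+6_1+6_1+6_2$ contributes $3+3+6+6=18$ to $H_3(30)$. *)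

(* Defs.v *)
From mathcomp Require Import all_boot all_order all_algebra.
From mathcomp Require Import finmap multiset.
From mathcomp Require Import mathcomp_extra boolp classical_sets functions.
From mathcomp Require Import cardinality fsbigop.

Set Implicit Arguments.
Unset Strict Implicit.
Unset Printing Implicit Defensive.

Local Open Scope classical_set_scope.
Local Open Scope mset_scope.
Local Open Scope nat_scope.

(* [(r, c)] is the part [r_c]; the [b] colors are the elements of ['I_b].
   The condition [r >= 1] is imposed in [colored_partition]. *)
Notation colored_part b := (nat * 'I_b)%type (only parsing).

Definition colored_partition (b n : nat) : set {mset colored_part b} :=
  [set pi : {mset colored_part b} |
            (forall p : colored_part b, p \in pi -> 1 <= p.1) /\
            \sum_(p <- pi) p.1 = n].
Arguments colored_partition b n : clear implicits.

Definition parts_of_size (b k : nat) (pi : {mset colored_part b}) : nat :=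
  count (fun p : colored_part b => p.1 == k) pi.

(* [undup] keeps one copy of each colored part, whatever its multiplicity. *)
Definition distinct_multiples_sum (b k : nat) (pi : {mset colored_part b}) : nat :=
  \sum_(p <- undup pi | k %| p.1) p.1.

(* The two sums below use [\sum_(_ \in _)], which is only meaningful for finite
   support; the support is finite by [finite_colored_partition]. *)
Definition F (b k n : nat) : nat :=
  (\sum_(pi \in colored_partition b n) parts_of_size k pi)%R.

Definition H (b k : nat) (m : int) : nat :=
  match m with
  | Posz n => (\sum_(pi \in colored_partition b n) distinct_multiples_sum k pi)%R
  | Negz _ => 0
  end.

Lemma finite_colored_partition (b n : nat) : finite_set (colored_partition b n).
Proof.
pose T := {ffun 'I_n.+1 * 'I_b -> 'I_n.+1}.
pose s (f : T) : seq (nat * 'I_b) :=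
  flatten [seq nseq (f x) (val x.1, x.2) | x <- enum {: 'I_n.+1 * 'I_b}].
apply: (@sub_finite_set _ _ [set seq_mset (s f) | f in [set: T]]); last first.
  exact/finite_image/finite_finset.
move=> pi /= [pi_gt0 pi_sum].
have le_part (p : nat * 'I_b) : (pi p * p.1 <= n) /\ (pi p <= n).
  have hp : pi p * p.1 <= n.
    rewrite -pi_sum -count_mem_mset.
    elim: (enum_mset pi) => [|q l IHl]; first by rewrite big_nil.
    rewrite big_cons /= mulnDl leq_add //.
    by case: eqP => [->|_]; rewrite ?mul1n ?mul0n.
  split=> //; have [/pi_gt0 p_gt0|/mset_eq0P-> //] := boolP (p \in pi).
  by apply: leq_trans hp; rewrite leq_pmulr.
exists [ffun x => inord (pi (val x.1, x.2))] => //.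
apply/msetP => p; rewrite mset_seqE /s count_flatten -map_comp sumn_map.
under eq_bigr => x _.
  rewrite /= count_nseq ffunE inordK ?ltnS; last exact: (le_part _).2.
  over.
rewrite /= big_enum /=.
have [pi_p|/mset_eq0P pi_p0] := boolP (p \in pi).
  have lt_p : p.1 < n.+1.
    rewrite ltnS; apply: leq_trans (le_part p).1.
    by rewrite leq_pmull // mset_gt0.
  rewrite (bigD1 (Ordinal lt_p, p.2)) //= -surjective_pairing eqxx mul1n.
  rewrite big1 ?addn0 // => -[i c] /= ne.
  case: eqP => // eq_p; case/eqP: ne.
  by congr (_, _); [apply: val_inj|]; rewrite /= -eq_p.
rewrite big1 // => x _; case: eqP => [->|_]; last by rewrite mul0n.
by rewrite mul1n pi_p0.
Qed.

(* Main.v *)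
(* Adjoining [j] copies of a part of size [r] shows that the partitions of [n]
   in which that part has multiplicity at least [j] are equinumerous with all
   partitions of [n - j * r].  Writing [p] for the number of partitions, this
   gives [F_k(n) = b * sum_(j >= 1) p(n - k j)] (count multiplicities by levels)
   and [H_k(n) = b * sum_(j >= 1) k j * p(n - k j)] (the case of multiplicity at
   least 1).  In [H_k(n) - H_k(n - k)] the coefficient of [p(n - k j)] is
   [b k (j - (j - 1)) = b k]. *)
Require Import Defs.
From mathcomp Require Import all_boot all_order all_algebra.
From mathcomp Require Import finmap multiset boolp classical_sets cardinality.
From mathcomp Require Import fsbigop zify.

Set Implicit Arguments.
Unset Strict Implicit.
Unset Printing Implicit Defensive.

Local Open Scope mset_scope.
Local Open Scope nat_scope.

Definition partitions (b n : nat) := fset_set (colored_partition b n).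

(** The guard matters: truncated subtraction would otherwise count the empty partition whenever
    [m > n]. *)
Definition num_partitions_sub (b n m : nat) : nat :=
  if m <= n then size (partitions b (n - m)) else 0.

Lemma mem_partitions b n (pi : {mset nat * 'I_b}) :
  reflect ((forall p, p \in pi -> 1 <= p.1) /\ \sum_(p <- pi) p.1 = n)
          (pi \in partitions b n).
Proof.
rewrite in_fset_set; last exact: finite_colored_partition.
exact: asboolP.
Qed.

Lemma perm_enum_msetD (K : choiceType) (A B : {mset K}) :
  perm_eq (A `+` B) (enum_mset A ++ enum_mset B).
Proof.
apply/eq_seq_msetP/msetP => a.
by rewrite !mset_seqE count_cat !count_mem_mset msetE2.
Qed.

Lemma mem_partitions_msetD b n j (p : nat * 'I_b) pi : 0 < p.1 ->
  (pi `+` msetn j p \in partitions b (n + j * p.1)) = (pi \in partitions b n).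
Proof.
move=> p_gt0.
have sumE : \sum_(q <- pi `+` msetn j p) q.1 = \sum_(q <- pi) q.1 + j * p.1.
  rewrite (perm_big _ (perm_enum_msetD _ _)) big_cat /= big_msetn.
  by rewrite Monoid.iteropE /= iter_addn_0 mulnC.
apply/mem_partitions/mem_partitions => -[pos].
  rewrite sumE => /addIn ->; split=> // q q_pi.
  by apply: pos; rewrite in_msetD q_pi.
rewrite sumE => ->; split=> // q; rewrite in_msetD => /orP[/pos //|].
by rewrite in_msetn => /andP[_ /eqP->].
Qed.

Lemma count_multiplicity_geq b n j (p : nat * 'I_b) : 0 < p.1 ->
  \sum_(pi <- partitions b n) (j <= pi p : nat) =
  num_partitions_sub b n (j * p.1).
Proof.
move=> p_gt0; rewrite /num_partitions_sub.
have msetBK (pi : {mset nat * 'I_b}) :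
    j <= pi p -> (pi `\` msetn j p) `+` msetn j p = pi.
  move=> le_j; apply/msetP => q; rewrite !msetE2 msetnE.
  by case: eqP => [->|_]; rewrite ?subnK // subn0 addn0.
have msetDK : cancel (fun pi : {mset nat * 'I_b} => pi `+` msetn j p)
                       (fun pi => pi `\` msetn j p).
  by move=> pi; apply/msetP => q; rewrite !msetE2 addnK.
rewrite -big_mkcond /= sum1_count -size_filter.
case: leqP => [le_n|gt_n].
  rewrite -[RHS](size_map (fun pi => pi `+` msetn j p)).
  apply/perm_size/uniq_perm.
  - by rewrite filter_uniq ?fset_uniq.
  - by rewrite (map_inj_uniq (can_inj msetDK)) fset_uniq.
  move=> pi; rewrite mem_filter; apply/andP/mapP => [[le_j pi_n]|[rho rho_n ->]].
    exists (pi `\` msetn j p); last by rewrite msetBK.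
    by rewrite -(mem_partitions_msetD _ j _ p_gt0) msetBK // subnK.
  rewrite msetE2 msetnxx leq_addl; split=> //.
  by rewrite -(subnK le_n) mem_partitions_msetD.
(* Here [j] copies of [p] alone already weigh more than [n], so no partition of [n] contains
   them. *)
apply/eqP; rewrite size_filter -leqn0 leqNgt -has_count -all_predC.
apply/allP => pi pi_n /=; apply/negP => le_j.
move: pi_n; rewrite -{1}(msetBK _ le_j) => /mem_partitions[_].
rewrite (perm_big _ (perm_enum_msetD _ _)) big_cat /= big_msetn.
by rewrite Monoid.iteropE /= iter_addn_0; lia.
Qed.

Lemma multiplicity_mul_leq b n (pi : {mset nat * 'I_b}) p :
  pi \in partitions b n -> pi p * p.1 <= n.
Proof.
case/mem_partitions=> _ <-; rewrite -count_mem_mset.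
elim: (enum_mset pi) => [|q l IHl]; first by rewrite big_nil.
rewrite big_cons /= mulnDl leq_add //.
by case: eqP => [->|_]; rewrite ?mul1n ?mul0n.
Qed.

(** Splits a multiplicity [x] into its levels [1, ..., x]; any cutoff [m >= x] captures all of
    them. *)
Lemma sum_leq_ord m x : \sum_(i < m) (i.+1 <= x : nat) = minn m x.
Proof.
elim: m => [|m IHm]; first by rewrite big_ord0 min0n.
by rewrite big_ord_recr IHm /=; case: leqP; lia.
Qed.

(** The cutoff [m] is left free because terms with [k * i.+1 > n] vanish; sums for different [n] can
    then be given matching ranges. *)
Lemma F_sum b k n m : 0 < k -> n <= m ->
  F b k n = b * \sum_(i < m) num_partitions_sub b n (k * i.+1).
Proof.
move=> k_gt0 le_nm.
have -> : F b k n = \sum_(pi <- partitions b n) parts_of_size k pi.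
  by rewrite /F fsbig_finite //; apply: finite_colored_partition.
transitivity (\sum_(pi <- partitions b n) \sum_(c < b) \sum_(i < m)
                (i.+1 <= pi (k, c) : nat)).
  rewrite big_seq [RHS]big_seq; apply: eq_bigr => pi pi_n.
  transitivity (\sum_(c < b) pi (k, c)).
    under eq_bigr do rewrite -count_mem_mset.
    rewrite /parts_of_size; elim: (enum_mset pi) => [|[r c] l IHl] /=.
      by rewrite big1.
    rewrite big_split /= -IHl; congr (_ + _).
    rewrite (bigD1 c) //= xpair_eqE eqxx andbT big1 ?addn0 //.
    by move=> d ne_dc; rewrite xpair_eqE eq_sym [c == d]eq_sym (negPf ne_dc) andbF.
  (* The cutoff loses no level: [pi (k, c) <= pi (k, c) * k <= n <= m]. *)
  apply: eq_bigr => c _; rewrite sum_leq_ord; apply/esym/minn_idPr.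
  apply: leq_trans le_nm; apply: leq_trans (multiplicity_mul_leq (k, c) pi_n).
  by rewrite leq_pmulr.
rewrite exchange_big /=.
transitivity (\sum_(c < b) \sum_(i < m) num_partitions_sub b n (k * i.+1));
  last by rewrite sum_nat_const card_ord.
apply: eq_bigr => c _; rewrite exchange_big /=; apply: eq_bigr => i _.
by rewrite count_multiplicity_geq // mulnC.
Qed.

(** Parts of [pi] are positive and at most [n], so those divisible by [k] lie among the
    [(k * i.+1, c)] with [i < m]. Both sides then sum sizes over duplicate-free lists with the same
    members. *)
Lemma distinct_multiples_sumE b k n m (pi : {mset nat * 'I_b}) :
  0 < k -> n <= m -> pi \in partitions b n ->
  distinct_multiples_sum k pi =
  \sum_(i < m) \sum_(c < b) k * i.+1 * (1 <= pi (k * i.+1, c)).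
Proof.
move=> k_gt0 le_nm pi_n.
transitivity (\sum_(p <- [seq (k * i.+1, c) | i : 'I_m <- enum 'I_m, c : 'I_b <- enum 'I_b]
                   | p \in pi) p.1); last first.
  rewrite big_mkcond big_allpairs_dep /= big_enum; apply: eq_bigr => i _.
  rewrite big_enum; apply: eq_bigr => c _ /=.
  by rewrite mset_gt0; case: ifP; rewrite ?muln1 ?muln0.
rewrite /distinct_multiples_sum -big_filter -[RHS]big_filter.
apply/perm_big/uniq_perm.
- by rewrite filter_uniq ?undup_uniq.
- rewrite filter_uniq // allpairs_uniq ?enum_uniq //.
  move=> [i c] [j d] _ _ /= [/eqP]; rewrite eqn_pmul2l // eqSS => /eqP eq_ij ->.
  by congr (_, _); apply: val_inj.
move=> [r c]; rewrite !mem_filter mem_undup andbC /=.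
case: (boolP ((r, c) \in pi)) => //= rc_pi.
apply/idP/allpairsP => [/dvdnP[q def_r]|[[i d] /= [_ _ [-> _]]]]; last first.
  exact: dvdn_mulr.
have r_gt0 : 0 < r by case/mem_partitions: pi_n => /(_ _ rc_pi).
have le_rn : r <= n.
  apply: leq_trans (multiplicity_mul_leq (r, c) pi_n).
  by rewrite leq_pmull // mset_gt0.
(* Size 0, also a multiple of [k], must be excluded before [q.-1] can serve as the index. *)
have q_gt0 : 0 < q by move: r_gt0; rewrite def_r muln_gt0 => /andP[].
have lt_q : q.-1 < m.
  rewrite prednK //; apply: leq_trans le_nm; apply: leq_trans le_rn.
  by rewrite def_r leq_pmulr.
exists (Ordinal lt_q, c); rewrite !mem_enum; split=> //=.
by rewrite prednK // mulnC -def_r.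
Qed.

Lemma H_sum b k n m : 0 < k -> n <= m ->
  H b k (Posz n) =
  b * \sum_(i < m) k * i.+1 * num_partitions_sub b n (k * i.+1).
Proof.
move=> k_gt0 le_nm.
have -> : H b k (Posz n) =
          \sum_(pi <- partitions b n) distinct_multiples_sum k pi.
  by rewrite /H fsbig_finite //; apply: finite_colored_partition.
rewrite big_seq.
under eq_bigr => pi pi_n do rewrite (distinct_multiples_sumE k_gt0 le_nm pi_n).
rewrite -big_seq exchange_big big_distrr; apply: eq_bigr => i _ /=.
rewrite exchange_big /=.
transitivity (\sum_(c < b) k * i.+1 * num_partitions_sub b n (k * i.+1));
  last by rewrite sum_nat_const card_ord.
apply: eq_bigr => c _; rewrite -big_distrr /=.
by rewrite count_multiplicity_geq ?muln_gt0 ?k_gt0 // mul1n.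
Qed.

Lemma H_recurrence b k n : 0 < k -> k <= n ->
  H b k (Posz n) = k * F b k n + H b k (Posz (n - k)).
Proof.
move=> k_gt0 le_kn.
rewrite (H_sum _ k_gt0 (leqnSn n)) (F_sum _ k_gt0 (leqnSn n)).
rewrite (H_sum _ k_gt0 (leq_subr k n)) mulnCA -mulnDr; congr (_ * _).
(* Removing [k] from [n] shifts the index by one: [(n - k) - k * i.+1 = n - k * i.+2]. The added
   term at [i = 0] has coefficient 0, and the extra index explains the cutoffs [n] and [n.+1]. By
   [k <= n], the guards on the two sides agree. *)
have -> : \sum_(i < n) k * i.+1 * num_partitions_sub b (n - k) (k * i.+1) =
          \sum_(i < n.+1) k * i * num_partitions_sub b n (k * i.+1).
  rewrite [RHS]big_ord_recl muln0 mul0n add0n; apply: eq_bigr => i _ /=.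
  rewrite /bump /= add1n /num_partitions_sub [k * i.+2]mulnS -subnDA.
  by rewrite leq_subRL.
rewrite big_distrr -big_split; apply: eq_bigr => i _ /=.
by rewrite mulnS mulnDl.
Qed.

Theorem theorem3 (b k n : nat) (hb : 0 < b) (hk : 0 < k) (hn : 0 < n) :
  ((k * F b k n)%N%:Z = (H b k n%:Z)%:Z - (H b k (n%:Z - k%:Z))%:Z)%R.
Proof.
have [le_kn|lt_nk] := leqP k n.
  by rewrite (subzn le_kn) (H_recurrence b hk le_kn) PoszD GRing.addrK.
(* For [n < k] the shifted argument is negative, and both remaining sums vanish because every
   [k * i.+1] exceeds [n]. *)
have -> : H b k (n%:Z - k%:Z)%R = 0.
  by rewrite (_ : (n%:Z - k%:Z)%R = Negz (k - n).-1) //; lia.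
rewrite (F_sum b hk (leqnn n)) (H_sum b hk (leqnn n)).
have none i : num_partitions_sub b n (k * i.+1) = 0.
  by rewrite /num_partitions_sub ifN // -ltnNge; nia.
rewrite !big1 ?muln0 // => i _; by rewrite none ?muln0.
Qed.
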